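(* Let $\mathcal{A}$ be a minimally self-adjusting BST algorithm. Suppose there are constants $c>0$ and $C\ge 0$ such that for every access performed by $\mathcal{A}$ (to an element $s$, with search path $P$ and after-tree $A$): (i) the number of leaves of $A$ is at least $c\,(|P|-z)$, where $z$ is the number of side alternations of $P$; and (ii) every element $t>s$ of $A$ has right-depth at most $C$ in $A$, and every element $t<s$ of $A$ has left-depth at most $C$ in $A$. Then $\mathcal{A}$ satisfies the access lemma.
   Context: Keys are $[n]=\{1,\dots,n\}$. For a BST $T$ on $[n]$ and a node $a$, $T(a)$ denotes the set of keys in the subtree of $T$ rooted at $a$. A weight function is $w:[n]\to\mathbb{R}_{>0}$, with $w(S)=\sum_{a\in S}w(a)$ and $W=w([n])$. For $X\subseteq[n]$, $\Phi_T(X)=\sum_{a\in X}\log_2 w(T(a))$, and $\Phi_T=\Phi_T([n])$ (sum-of-logs, SOL, potential). A minimally self-adjusting BST algorithm works as follows: when key $s$ is accessed in the current tree $T$, let $P$ be the search path (the set of nodes on the path from the root of $T$ to $s$, including $s$). The algorithm replaces $P$ by a BST $A$ on the node set $P$ whose root is $s$ (the after-tree); the subtrees of $T$ hanging off $P$ are reattached to $A$ in the unique way consistent with the key order, giving the new tree $T'$. The cost of the access is $|P|$. The algorithm satisfies the access lemma (via the SOL potential) if there is a constant $c'$ such that for all $n$, all BSTs $T$ on $[n]$, all weight functions $w$, all $s\in[n]$ and all trees $T'$ the algorithm can produce when accessing $s$ in $T$: $|P|\le \Phi_T-\Phi_{T'}+c'(1+\log_2\frac{W}{w(s)})$. The right-depth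 (left-depth) of a node in a tree is the number of right-going (left-going) edges on the path from the root to the node. The number of side alternations of $P$ is the number of edges of the search path $P$ that join a node smaller than $s$ to a node larger than $s$. *)

(* Defs.v *)
From HB Require Import structures.
From mathcomp Require Import all_boot all_order all_algebra.
From mathcomp Require Import reals exp.

Set Implicit Arguments.
Unset Strict Implicit.
Unset Printing Implicit Defensive.

Import Order.TTheory GRing.Theory Num.Theory.

Local Open Scope ring_scope.

Inductive tree : Type :=
| Empty
| Node (l : tree) (k : nat) (r : tree).

Fixpoint inorder (T : tree) : seq nat :=
  if T is Node l k r then inorder l ++ k :: inorder r else [::].

(* T is a binary search tree whose node set is exactly X. *)
Definition bst_on (X : seq nat) (T : tree) : Prop :=
  sorted ltn (inorder T) /\ inorder T =i X.

Definition keys (n : nat) : seq nat := iota 1 n.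

Definition root_is (s : nat) (T : tree) : Prop :=
  if T is Node _ k _ then k = s else False.

(* The functions below navigate by key comparison, so they have their intended
   meaning on search trees, for keys occurring in the tree. *)

Fixpoint subtree (T : tree) (a : nat) : tree :=
  if T is Node l k r then
    if a == k then T else if (a < k)%N then subtree l a else subtree r a
  else Empty.

Fixpoint search_path (T : tree) (s : nat) : seq nat :=
  if T is Node l k r then
    k :: (if s == k then [::]
          else if (s < k)%N then search_path l s else search_path r s)
  else [::].

Fixpoint right_depth (T : tree) (a : nat) : nat :=
  if T is Node l k r then
    if a == k then 0%N
    else if (a < k)%N then right_depth l a else (right_depth r a).+1
  else 0%N.

Fixpoint left_depth (T : tree) (a : nat) : nat :=
  if T is Node l k r then
    if a == k then 0%N
    else if (a < k)%N then (left_depth l a).+1 else left_depth r a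
  else 0%N.

Fixpoint num_leaves (T : tree) : nat :=
  match T with
  | Empty => 0
  | Node Empty _ Empty => 1
  | Node l _ r => num_leaves l + num_leaves r
  end%N.

Definition side_alternations (P : seq nat) (s : nat) : nat :=
  count (fun e : nat * nat => (e.1 < s < e.2)%N || (e.2 < s < e.1)%N)
        (zip P (behead P)).

(* The subtrees of T hanging off the search path of s, from left to right.  A
   missing child of a path node counts as an Empty subtree, so a path of m
   nodes yields m.+1 subtrees, one for each gap between path keys. *)
Fixpoint hanging (T : tree) (s : nat) : seq tree :=
  if T is Node l k r then
    if s == k then [:: l; r]
    else if (s < k)%N then rcons (hanging l s) r else l :: hanging r s
  else [:: Empty].

(* Replaces the empty positions of A, from left to right, by the trees ts; a
   tree with m nodes has m.+1 empty positions. *)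
Fixpoint attach (A : tree) (ts : seq tree) : tree :=
  if A is Node l k r then
    let m := (size (inorder l)).+1 in
    Node (attach l (take m ts)) k (attach r (drop m ts))
  else head Empty ts.

(* The tree T' that results from accessing s in T with after-tree A. *)
Definition tree_after (T : tree) (s : nat) (A : tree) : tree :=
  attach A (hanging T s).

(* alg T s A means that A is a possible after-tree when s is accessed in T; the
   algorithm may be nondeterministic. *)
Definition algorithm := tree -> nat -> tree -> Prop.

Definition minimally_self_adjusting (alg : algorithm) : Prop :=
  forall (n : nat) (T : tree) (s : nat),
    bst_on (keys n) T -> s \in keys n ->
    (exists A, alg T s A) /\
    (forall A, alg T s A -> bst_on (search_path T s) A /\ root_is s A).

Section Potential.
Variable R : realType.
Implicit Types (w : nat -> R) (T : tree) (X : seq nat).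

Definition log2 (x : R) : R := ln x / ln 2%:R.

Definition weight w X : R := \sum_(a <- X) w a.

Definition potential w T X : R :=
  \sum_(a <- X) log2 (weight w (inorder (subtree T a))).

Definition access_lemma (alg : algorithm) : Prop :=
  exists c' : R,
    forall (n : nat) (T : tree) (w : nat -> R) (s : nat) (A : tree),
      bst_on (keys n) T ->
      (forall a, a \in keys n -> 0 < w a) ->
      s \in keys n ->
      alg T s A ->
      (size (search_path T s))%:R <=
        potential w T (keys n) - potential w (tree_after T s A) (keys n)
        + c' * (1 + log2 (weight w (keys n) / w s)).

End Potential.

(* Main.v *)
Require Import Defs.
From mathcomp Require Import all_boot all_order all_algebra.
From mathcomp Require Import reals sequences exp.
From mathcomp Require Import zify ring lra.

Import Order.TTheory GRing.Theory Num.Theory.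

Local Open Scope ring_scope.

(* Let [rho t] be half of [w s] plus the weight of the keys of [T(t)] on the same
   side of [s] as [t]. Among the nodes above [s] with a given right-depth in the
   after-tree, listed as t_1 < t_2 < ..., the new subtree of t_i lies strictly
   between [s] and t_{i+1}, so its weight is at most [rho] of t_{i+1}; summing
   logarithms over the boundedly many levels loses only O(1 + log (W / w s))
   against the sum of the [log (rho t)]. Symmetrically below [s].
   - Passing from [T(t)] to [rho t] gains at least one unit (in base 2) per side
     alternation, up to O(log (W / w s)), by AM-GM applied to the two sides.
   - The leaves of the after-tree carry disjoint weights, so up to
     O_K(1 + log (W / w s)) each of them gains [K] more than its share. Choosing
     [K] inversely proportional to [c] makes the leaves pay for the remaining
     [|P| - z] nodes of the path. *)

(** * Reflection of trees and levels of right-depth *)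

Fixpoint mirror (T : tree) : tree :=
  if T is Node l k r then Node (mirror r) k (mirror l) else Empty.

Lemma inorder_mirror T : inorder (mirror T) = rev (inorder T).
Proof.
by elim: T => //= l IHl k r IHr; rewrite IHl IHr rev_cat rev_cons cat_rcons.
Qed.

Lemma num_leaves_node l k r :
  num_leaves (Node l k r) =
    if (l, r) is (Empty, Empty) then 1%N else (num_leaves l + num_leaves r)%N.
Proof. by case: l r => [|? ? ?] [|? ? ?]. Qed.

Lemma num_leaves_mirror T : num_leaves (mirror T) = num_leaves T.
Proof.
elim: T => // l IHl k r IHr.
rewrite [mirror _]/= !num_leaves_node IHl IHr addnC.
by case: l {IHl} => [|? ? ?]; case: r {IHr}.
Qed.

(** One more than the largest right-depth, and zero for the empty tree: the number of level entries
    that a scan of the tree needs. *)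
Fixpoint right_levels (T : tree) : nat :=
  if T is Node l _ r then maxn (right_levels l) (right_levels r).+1 else 0%N.

Lemma sorted_cat_consP {s1 s2 : seq nat} {k : nat} :
  sorted ltn (s1 ++ k :: s2) ->
  [/\ sorted ltn s1, sorted ltn s2,
      forall a, a \in s1 -> (a < k)%N & forall a, a \in s2 -> (k < a)%N].
Proof.
rewrite !(sorted_pairwise ltn_trans) pairwise_cat pairwise_cons.
move=> /and4P[/allrelP h12 h1 /allP h2 h22]; split=> // a ha.
by apply: h12; rewrite // mem_head.
Qed.

Lemma right_levels_le T D :
  sorted ltn (inorder T) ->
  (forall t, t \in inorder T -> (right_depth T t < D)%N) ->
  (right_levels T <= D)%N.
Proof.
elim: T D => //= l IHl k r IHr [|D] /sorted_cat_consP[sl sr ltk gtk] hD.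
  by have := hD k; rewrite mem_cat mem_head orbT => /(_ isT).
rewrite geq_max ltnS; apply/andP; split.
  apply: IHl => // t tl; have := hD t; rewrite mem_cat tl => /(_ isT).
  by rewrite ltk // ltn_eqF // ltk.
apply: IHr => // t tr; have := hD t.
rewrite mem_cat inE tr !orbT => /(_ isT).
by rewrite gtn_eqF ?gtk // (ltnNge t k) (ltnW (gtk _ tr)).
Qed.

Lemma right_levels_mirror_le T D :
  sorted ltn (inorder T) ->
  (forall t, t \in inorder T -> (left_depth T t < D)%N) ->
  (right_levels (mirror T) <= D)%N.
Proof.
elim: T D => //= l IHl k r IHr [|D] /sorted_cat_consP[sl sr ltk gtk] hD.
  by have := hD k; rewrite mem_cat mem_head orbT => /(_ isT).
rewrite geq_max ltnS; apply/andP; split.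
  apply: IHr => // t tr; have := hD t.
  rewrite mem_cat inE tr !orbT => /(_ isT).
  by rewrite gtn_eqF ?gtk // (ltnNge t k) (ltnW (gtk _ tr)).
apply: IHl => // t tl; have := hD t; rewrite mem_cat tl => /(_ isT).
by rewrite ltk // ltn_eqF // ltk.
Qed.

(** * Sums of logarithms of interval lengths *)

Section Intervals.
Variable R : realType.
Implicit Types (pm pp rho : nat -> R) (B : tree).

(* Key [k] occupies the interval [pm k, pp k] of a line on which the keys are
   laid out one after the other, each with length its weight; the subtree whose
   keys fill [a, b] has weight [b - a]. *)
Fixpoint interval_logs pm pp B (a b : R) : R :=
  if B is Node l k r then
    ln (b - a) + interval_logs pm pp l a (pm k) + interval_logs pm pp r (pp k) b
  else 0.

Fixpoint layout pm pp B (a b : R) : Prop :=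
  if B is Node l k r then
    [/\ layout pm pp l a (pm k), pm k < pp k & layout pm pp r (pp k) b]
  else a <= b.

Lemma layout_le pm pp B a b : layout pm pp B a b -> a <= b.
Proof.
elim: B a b => //= l IHl k r IHr a b [/IHl h1 h2 /IHr h3]; lra.
Qed.

(** Only differences of endpoints enter, so the keys above [s] can be moved to start at [w s / 2];
    the scan needs a positive left end. *)
Lemma interval_logs_shift pm pp c B a b :
  interval_logs (fun k => c + pm k) (fun k => c + pp k) B (c + a) (c + b)
  = interval_logs pm pp B a b.
Proof.
elim: B a b => //= l IHl k r IHr a b; rewrite IHl IHr.
by congr (ln _ + _ + _); ring.
Qed.

Lemma layout_shift pm pp c B a b :
  layout pm pp B a b ->
  layout (fun k => c + pm k) (fun k => c + pp k) B (c + a) (c + b).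
Proof.
elim: B a b => /= [|l IHl k r IHr] a b; first by rewrite lerD2l.
by case=> /IHl hl hk /IHr hr; split; rewrite // ltrD2l.
Qed.

(** The reflection at [c] exchanges left and right ends, which reduces the keys below [s] to the
    case of keys above [s]. *)
Lemma interval_logs_mirror pm pp c B a b :
  interval_logs (fun k => c - pp k) (fun k => c - pm k) (mirror B)
    (c - b) (c - a)
  = interval_logs pm pp B a b.
Proof.
elim: B a b => //= l IHl k r IHr a b; rewrite IHl IHr addrAC.
by congr (ln _ + _ + _); ring.
Qed.

Lemma layout_mirror pm pp c B a b :
  layout pm pp B a b ->
  layout (fun k => c - pp k) (fun k => c - pm k) (mirror B) (c - b) (c - a).
Proof.
elim: B a b => /= [|l IHl k r IHr] a b; first by rewrite lerD2l lerN2.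
by case=> /IHl hl hk /IHr hr; split; rewrite // ltrD2l ltrN2.
Qed.

Lemma ln_le_subr1 (x : R) : 0 < x -> ln x <= x - 1.
Proof. 
move=> x0; rewrite -{1}(subrKC 1 x); apply: le_ln1Dx; lra.
 Qed.

(* A leaf gains [K] more than its share, up to an error that telescopes over
   disjoint intervals. *)
Lemma leaf_gain (K a b u : R) :
  0 < a -> a < b -> b <= u ->
  ln (b - a) + K <= ln u + expR K * (ln b - ln a).
Proof.
move=> a0 ab bu.
have b0 : 0 < b by lra.
have ba0 : 0 < b - a by lra.
have u0 : 0 < u by lra.
have h1 : 1 - a / b <= ln b - ln a.
  have := ln_le_subr1 (a / b) (divr_gt0 a0 b0).
  by rewrite ln_div ?posrE //; lra.
(* Scaling the share [(b - a) / u] by [expR K] before applying [ln x <= x - 1] produces the extra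
   [K] on the left and the factor [expR K] of the error. *)
have h2 : ln ((b - a) / u * expR K) <= (b - a) / u * expR K - 1.
  by apply: ln_le_subr1; rewrite !mulr_gt0 ?invr_gt0 ?expR_gt0.
rewrite lnM ?posrE ?divr_gt0 ?expR_gt0 // expRK ln_div ?posrE // in h2.
have h3 : (b - a) / u <= 1 - a / b.
  have -> : 1 - a / b = (b - a) / b by field; lra.
  by rewrite ler_wpM2l ?lef_pV2 ?posrE //; lra.
have h4 : expR K * ((b - a) / u) <= expR K * (ln b - ln a).
  by rewrite ler_wpM2l ?expR_ge0 //; lra.
lra.
Qed.

(* [U] holds, for each right-depth level, a bound on the subtree weights of that
   level; scanning the keys from right to left, the next key [k] of the level is
   charged to the current entry, which is then replaced by [rho k]. [V] is the
   state of the bounds after the scan. *)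
Lemma interval_logs_scan pm pp rho (K : R) B (a b : R) (U : seq R) :
  0 <= K -> 0 < a -> layout pm pp B a b ->
  (forall k, k \in inorder B -> pm k <= rho k) ->
  (right_levels B <= size U)%N ->
  (forall u, u \in U -> b <= u) ->
  exists V : seq R, [/\ size V = size U, forall v, v \in V -> a <= v &
    interval_logs pm pp B a b + K * (num_leaves B)%:R + \sum_(v <- V) ln v
    <= \sum_(k <- inorder B) ln (rho k) + \sum_(u <- U) ln u
       + expR K * (ln b - ln a)].
Proof.
move=> K0.
elim: B a b U => [|l IHl k r IHr] a b U a0 /= hlay hrho hU hb.
  exists U; split=> // [v /hb|]; first lra.
  have : 0 <= expR K * (ln b - ln a).
    by rewrite mulr_ge0 ?expR_ge0 // subr_ge0 ler_ln ?posrE //; lra.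
  by rewrite big_nil; lra.
case: hlay => layl pmk layr.
case: U hU hb => [|u U]; first by rewrite leqn0 -leqn0 geq_max andbF.
rewrite geq_max /= ltnS => /andP[hUl hUr] hb.
have le_a := @layout_le _ _ _ _ _ layl.
have le_b := @layout_le _ _ _ _ _ layr.
have bu : b <= u by apply: hb; rewrite mem_head.
have rk : pm k <= rho k by apply: hrho; rewrite mem_cat mem_head orbT.
have hab : ln (b - a) <= ln u by rewrite ler_ln ?posrE; lra.
have [[el er]|nleaf] : (l = Empty /\ r = Empty) \/
    num_leaves (Node l k r) = (num_leaves l + num_leaves r)%N.
- rewrite num_leaves_node; case: l {IHl layl hUl le_a hrho} => [|? ? ?].
    by case: r {IHr layr hUr le_b} => [|? ? ?]; [left|right].
  by right.
- subst l r; exists (rho k :: U); split=> //=.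
    move=> v; rewrite inE => /predU1P[->|vU]; first lra.
    by have := hb v; rewrite inE vU orbT => /(_ isT); lra.
  have := @leaf_gain K a b u a0 ltac:(lra) bu.
  by rewrite !big_cons big_nil; lra.
rewrite -/(num_leaves (Node l k r)) {}nleaf natrD.
(* The right subtree is scanned first. Its keys lie one right edge deeper than [k], so it uses only
   the entries behind the head, and [u] stays reserved for [k]. *)
have [V1 [sV1 V1a h1]] : exists V : seq R,
    [/\ size V = size U, forall v, v \in V -> pp k <= v &
    interval_logs pm pp r (pp k) b + K * (num_leaves r)%:R + \sum_(v <- V) ln v
    <= \sum_(k <- inorder r) ln (rho k) + \sum_(u <- U) ln u
       + expR K * (ln b - ln (pp k))].
  apply: IHr => //; first lra.
  - by move=> t tr; apply: hrho; rewrite mem_cat inE tr !orbT.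
  - by move=> v vU; apply: hb; rewrite inE vU orbT.
(* A left edge keeps the level of [k], so the left subtree is scanned with [rho k] at the head; this
   entry bounds the right end [pm k]. *)
have [V [sV Va h2]] : exists V : seq R,
    [/\ size V = (size U).+1, forall v, v \in V -> a <= v &
    interval_logs pm pp l a (pm k) + K * (num_leaves l)%:R + \sum_(v <- V) ln v
    <= \sum_(k <- inorder l) ln (rho k) + \sum_(u <- rho k :: V1) ln u
       + expR K * (ln (pm k) - ln a)].
  have -> : (size U).+1 = size (rho k :: V1) by rewrite /= sV1.
  apply: IHl => //=.
  - by move=> t tr; apply: hrho; rewrite mem_cat tr.
  - by rewrite sV1.
  - by move=> v; rewrite inE => /predU1P[->//|/V1a]; lra.
exists V; split=> //.
rewrite big_cat !big_cons /=.
rewrite big_cons in h2.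
have E0 := expR_ge0 K.
have lnk : ln (pm k) <= ln (pp k) by rewrite ler_ln ?posrE; lra.
have hE : expR K * (ln (pm k) - ln a) + expR K * (ln b - ln (pp k))
          <= expR K * (ln b - ln a).
  by rewrite -mulrDr ler_wpM2l //; lra.
lra.
Qed.

End Intervals.

Arguments interval_logs {R}.
Arguments layout {R}.

(** * Search paths, hanging subtrees and the key order of the new tree *)

Lemma sorted_node {l : tree} {k : nat} {r : tree} :
  sorted ltn (inorder (Node l k r)) ->
  [/\ sorted ltn (inorder l), sorted ltn (inorder r),
      forall a, a \in inorder l -> (a < k)%N &
      forall a, a \in inorder r -> (k < a)%N].
Proof. exact: sorted_cat_consP. Qed.

Lemma search_path_sub T s : {subset search_path T s <= inorder T}.
Proof.
elim: T => //= l IHl k r IHr a; rewrite inE mem_cat inE.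
case/predU1P => [->|]; first by rewrite eqxx orbT.
by case: eqP => // _; case: ltnP => _ => [/IHl|/IHr] ->; rewrite ?orbT.
Qed.

Lemma mem_left l k r s :
  sorted ltn (inorder (Node l k r)) -> s \in inorder (Node l k r) ->
  (s < k)%N -> s \in inorder l.
Proof.
move=> /sorted_node[_ _ _ gtk]; rewrite /= mem_cat inE.
case/or3P => // [/eqP->|/gtk h1 h2]; first by rewrite ltnn.
by have := ltn_trans h1 h2; rewrite ltnn.
Qed.

Lemma mem_right l k r s :
  sorted ltn (inorder (Node l k r)) -> s \in inorder (Node l k r) ->
  (k < s)%N -> s \in inorder r.
Proof.
move=> /sorted_node[_ _ ltk _]; rewrite /= mem_cat inE.
case/or3P => // [/ltk h1 h2|/eqP->]; last by rewrite ltnn.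
by have := ltn_trans h1 h2; rewrite ltnn.
Qed.

Lemma subtree_left l k r a :
  sorted ltn (inorder (Node l k r)) -> a \in inorder l ->
  subtree (Node l k r) a = subtree l a.
Proof. by move=> /sorted_node[_ _ h _] /h /= ak; rewrite ltn_eqF // ak. Qed.

Lemma subtree_right l k r a :
  sorted ltn (inorder (Node l k r)) -> a \in inorder r ->
  subtree (Node l k r) a = subtree r a.
Proof.
by move=> /sorted_node[_ _ _ h] /h /= ak; rewrite gtn_eqF // ltnNge ltnW.
Qed.

Lemma subtree_root l k r : subtree (Node l k r) k = Node l k r.
Proof. by rewrite /= eqxx. Qed.

(** On the descent to [k], every earlier path node has [s] and [k] on the same side, hence also each
    key between them. *)
Lemma subtree_path_convex T s k a :
  sorted ltn (inorder T) -> k \in search_path T s -> a \in inorder T ->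
  (s <= a <= k)%N || (k <= a <= s)%N -> a \in inorder (subtree T k).
Proof.
elim: T => //= l IHl k0 r IHr sT; have [sl sr ltk gtk] := sorted_node sT.
rewrite inE; have [-> _|nk0 /=] := eqVneq k k0; first by [].
have [_|ns] := eqVneq s k0; first by [].
case: ltnP => sk0 kp aT hak.
  have kl := @search_path_sub _ _ _ kp.
  rewrite (ltk _ kl); apply: IHl => //.
  by apply: (mem_left l k0 r a sT aT); have := ltk _ kl; move: hak sk0; lia.
have kr := @search_path_sub _ _ _ kp; have := gtk _ kr => k0k.
rewrite ltnNge ltnW //=; apply: IHr => //.
by apply: (mem_right l k0 r a sT aT); move: hak sk0 ns k0k; lia.
Qed.

(** The path keys from left to right rather than from the root down: the order in which the gaps
    between them receive the hanging subtrees. *)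
Fixpoint path_inorder (T : tree) (s : nat) : seq nat :=
  if T is Node l k r then
    if s == k then [:: k]
    else if (s < k)%N then rcons (path_inorder l s) k else k :: path_inorder r s
  else [::].

Lemma perm_path_inorder T s : perm_eq (path_inorder T s) (search_path T s).
Proof.
elim: T => //= l IHl k r IHr; case: eqP => // _; case: ltnP => _.
  by rewrite perm_rcons perm_cons.
by rewrite perm_cons.
Qed.

Lemma path_inorder_subseq T s : subseq (path_inorder T s) (inorder T).
Proof.
elim: T => //= l IHl k r IHr; case: eqP => _; last case: ltnP => _.
- by rewrite sub1seq mem_cat mem_head orbT.
- by rewrite -cats1 cat_subseq // sub1seq mem_head.
- by rewrite -[k :: path_inorder r s]cat0s cat_subseq ?sub0seq //= eqxx.
Qed.

Lemma size_hanging T s : size (hanging T s) = (size (path_inorder T s)).+1.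
Proof.
elim: T => //= l IHl k r IHr; case: eqP => // _; case: ltnP => _ /=.
  by rewrite !size_rcons IHl.
by rewrite IHr.
Qed.

(** The effect of [attach] on key lists, in which the shape of the after-tree no longer occurs. A
    missing tree counts as [Empty]. *)
Fixpoint interleave (ks : seq nat) (ts : seq tree) : seq nat :=
  if ks is k :: ks' then
    inorder (head Empty ts) ++ k :: interleave ks' (behead ts)
  else inorder (head Empty ts).

Lemma interleave_cat ks k ks' ts :
  interleave (ks ++ k :: ks') ts =
  interleave ks (take (size ks).+1 ts)
    ++ k :: interleave ks' (drop (size ks).+1 ts).
Proof.
elim: ks ts => [|k0 ks IH] [|t ts] //=; first by rewrite drop0.
  by rewrite (IH [::]).
by rewrite IH -catA.
Qed.

Lemma inorder_attach A ts : inorder (attach A ts) = interleave (inorder A) ts.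
Proof. by elim: A ts => //= l IHl k r IHr ts; rewrite IHl IHr interleave_cat. Qed.

Lemma interleave_hanging T s :
  interleave (path_inorder T s) (hanging T s) = inorder T.
Proof.
elim: T => //= l IHl k r IHr; case: eqP => // _; case: ltnP => _ /=.
  rewrite -cats1 interleave_cat -size_hanging -cats1 take_size_cat //.
  by rewrite drop_size_cat // IHl.
by rewrite IHr.
Qed.

(** The keys of [A] and the path keys are sorted lists with the same elements, hence equal;
    interleaving either with the hanging subtrees gives back the keys of [T]. *)
Lemma inorder_tree_after T s A :
  sorted ltn (inorder T) -> bst_on (search_path T s) A ->
  inorder A = path_inorder T s /\ inorder (tree_after T s A) = inorder T.
Proof.
move=> sT [sA eA].
have e : inorder A = path_inorder T s.
  apply: (irr_sorted_eq ltn_trans ltnn) => //.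
    exact: (subseq_sorted ltn_trans (path_inorder_subseq T s)).
  by move=> a; rewrite eA (perm_mem (perm_path_inorder T s)).
by split; rewrite // /tree_after inorder_attach e interleave_hanging.
Qed.

(** * Potentials as sums over subtrees, and weights of key lists *)

Section Weights.
Variable R : realType.
Implicit Types (w : nat -> R) (T A B : tree) (F : tree -> R).

(** With [F] the logarithm of the weight this is the SOL potential in natural units. Recursion on
    the shape avoids locating each subtree by key search. *)
Fixpoint tree_sum F T : R :=
  if T is Node l k r then F T + tree_sum F l + tree_sum F r else 0.

Lemma tree_sum_inorder F T : sorted ltn (inorder T) ->
  \sum_(a <- inorder T) F (subtree T a) = tree_sum F T.
Proof.
elim: T => [|l IHl k r IHr] sT; first by rewrite big_nil.
have [sl sr _ _] := sorted_node sT.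
rewrite [inorder _]/= big_cat big_cons subtree_root /=.
rewrite (eq_big_seq (fun a => F (subtree l a))); last first.
  by move=> a al; congr F; exact: (subtree_left l k r a sT al).
rewrite [X in _ + (_ + X)](eq_big_seq (fun a => F (subtree r a))); last first.
  by move=> a al; congr F; exact: (subtree_right l k r a sT al).
by rewrite IHl // IHr //; ring.
Qed.

(** An access moves the hanging subtrees without changing them, so their share, split off here,
    cancels between old and new potential. *)
Lemma tree_sum_path F T s : sorted ltn (inorder T) -> s \in inorder T ->
  tree_sum F T = \sum_(t <- search_path T s) F (subtree T t)
                 + \sum_(h <- hanging T s) tree_sum F h.
Proof.
elim: T => // l IHl k r IHr sT hs; have [sl sr _ _] := sorted_node sT.
have ml := mem_left l k r s sT hs; have mr := mem_right l k r s sT hs.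
rewrite [search_path _ _]/= big_cons subtree_root [hanging _ _]/=.
case: (ltngtP s k) => hsk.
- rewrite (eq_big_seq (fun a => F (subtree l a))); last first.
    by move=> a /search_path_sub al; congr F; exact: (subtree_left l k r a sT al).
  by rewrite -cats1 big_cat big_seq1 /= IHl ?ml //; ring.
- rewrite (eq_big_seq (fun a => F (subtree r a))); last first.
    by move=> a /search_path_sub al; congr F; exact: (subtree_right l k r a sT al).
  by rewrite big_cons /= IHr ?mr //; ring.
- by rewrite !big_cons !big_nil /=; ring.
Qed.

Lemma weight_cat w s1 s2 : weight w (s1 ++ s2) = weight w s1 + weight w s2.
Proof. exact: big_cat. Qed.

Lemma weight_cons w k s : weight w (k :: s) = w k + weight w s.
Proof. exact: big_cons. Qed.

Lemma weight_nil w : weight w [::] = 0.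
Proof. exact: big_nil. Qed.

Definition weightE := (weight_cat, weight_cons, weight_nil).

Lemma weight_ge0 w s : (forall a, a \in s -> 0 < w a) -> 0 <= weight w s.
Proof. by move=> hw; rewrite /weight big_seq sumr_ge0 // => a /hw/ltW. Qed.

Lemma weight_ge w s a : (forall a, a \in s -> 0 < w a) -> a \in s ->
  w a <= weight w s.
Proof.
move=> hw ha; rewrite /weight (perm_big _ (perm_to_rem ha)) big_cons lerDl.
by apply: weight_ge0 => b /mem_rem/hw.
Qed.

Lemma weight_filter_le w (p : pred nat) s : (forall a, a \in s -> 0 < w a) ->
  weight w [seq a <- s | p a] <= weight w s.
Proof.
move=> hw; rewrite [leRHS](bigID p) /weight big_filter /= lerDl.
by rewrite big_seq_cond sumr_ge0 // => a /andP[/hw/ltW].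
Qed.

Lemma weight_sub w s1 s2 : uniq s1 -> uniq s2 -> {subset s1 <= s2} ->
  (forall a, a \in s2 -> 0 < w a) -> weight w s1 <= weight w s2.
Proof.
move=> u1 u2 sub hw.
have e : perm_eq s1 [seq a <- s2 | a \in s1].
  apply: uniq_perm => //; first exact: filter_uniq.
  by move=> a; rewrite mem_filter; case: (boolP (a \in s1)) => // /sub ->.
by rewrite {1}/weight (perm_big _ e); apply: weight_filter_le.
Qed.

Lemma weight_split w s (I : seq nat) : uniq I -> s \in I ->
  weight w I = weight w [seq a <- I | (a < s)%N] + w s
               + weight w [seq a <- I | (s < a)%N].
Proof.
move=> uI sI; rewrite /weight (bigD1_seq s) //= (bigID (fun a => a < s)%N) /=.
rewrite addrCA addrA !big_filter; congr (_ + _ + _); apply: eq_bigl => a.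
  by case: ltngtP.
by rewrite andbC ltnNge; case: ltngtP.
Qed.

Lemma filter_below s1 k s2 : sorted ltn (s1 ++ k :: s2) ->
  [seq a <- s1 ++ k :: s2 | (a < k)%N] = s1.
Proof.
move=> /sorted_cat_consP[_ _ h1 h2]; rewrite filter_cat /= ltnn.
rewrite (eq_in_filter (a2 := predT)); last by move=> a /h1.
rewrite filter_predT (eq_in_filter (a2 := pred0)) ?filter_pred0 ?cats0 //.
by move=> a /h2 ka; rewrite ltnNge ltnW.
Qed.

(* Node [k] of a search tree with sorted key list [Z] occupies the interval
   from the weight of the keys below [k] to that weight plus [w k]. *)
Definition pos w (Z : seq nat) (k : nat) : R := weight w [seq a <- Z | (a < k)%N].

(** Positions refer to the fixed list [Z]; the contexts [X] and [Y] hold the keys of [Z] outside the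
    current subtree and grow during the recursion. *)
Lemma tree_sum_attach w Z B ts X Y :
  size ts = (size (inorder B)).+1 -> Z = X ++ inorder (attach B ts) ++ Y ->
  sorted ltn Z -> (forall a, a \in Z -> 0 < w a) ->
  let b := weight w (X ++ inorder (attach B ts)) in
  layout (pos w Z) (fun k => pos w Z k + w k) B (weight w X) b /\
  tree_sum (fun T => ln (weight w (inorder T))) (attach B ts)
  = interval_logs (pos w Z) (fun k => pos w Z k + w k) B (weight w X) b
    + \sum_(t <- ts) tree_sum (fun T => ln (weight w (inorder T))) t.
Proof.
elim: B ts X Y => [|l IHl k r IHr] ts X Y; set F := fun T : tree => _.
  case: ts => [|t []] //= _ -> sZ hw; split; last by rewrite big_seq1 add0r.
  rewrite weight_cat lerDl; apply: weight_ge0 => a ha; apply: hw.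
  by rewrite !mem_cat ha orbT.
rewrite [attach _ _]/= [inorder (Node _ _ _)]/= [inorder (Node _ _ _)]/=.
set m := (size (inorder l)).+1; set L := attach l _; set Q := attach r _.
rewrite size_cat /= addnS => sts eZ sZ hw.
have sts1 : size (take m ts) = m by rewrite size_takel // sts; lia.
have sts2 : size (drop m ts) = (size (inorder r)).+1 by rewrite size_drop sts; lia.
have eZl : Z = X ++ inorder L ++ (k :: inorder Q ++ Y) by rewrite eZ -!catA.
have eZr : Z = (X ++ inorder L ++ [:: k]) ++ inorder Q ++ Y by rewrite eZ -!catA.
have [layl suml] := IHl _ _ _ sts1 eZl sZ hw.
have [layr sumr] := IHr _ _ _ sts2 eZr sZ hw.
have wk : 0 < w k by apply: hw; rewrite eZ !mem_cat mem_head !orbT.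
have pk : pos w Z k = weight w (X ++ inorder L).
  by rewrite /pos eZl catA filter_below // -catA -eZl.
have eX : weight w (X ++ inorder L ++ [:: k]) = pos w Z k + w k.
  by rewrite pk !weightE; ring.
have eb : weight w ((X ++ inorder L ++ [:: k]) ++ inorder Q)
          = weight w (X ++ inorder L ++ k :: inorder Q).
  by rewrite -!catA.
rewrite /= -pk in layl suml; rewrite /= eX eb in layr sumr.
split; first by split=> //; rewrite ltrDl.
rewrite -/F in suml sumr.
rewrite -[in \sum_(t <- ts) _](cat_take_drop m ts) big_cat /= suml sumr /F /=.
rewrite (_ : weight w (X ++ _) - _ = weight w (inorder L ++ k :: inorder Q)).
  by ring.
by rewrite !weightE; ring.
Qed.

End Weights.

Arguments tree_sum {R}.
Arguments pos {R}.

(** * Gains of one-sided weights along the search path *)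

Lemma side_alternations_cons a b p s :
  side_alternations [:: a, b & p] s =
  (((a < s < b) || (b < s < a)) + side_alternations (b :: p) s)%N.
Proof. by []. Qed.

Section PathWeights.
Variables (R : realType) (w : nat -> R) (s : nat).
Implicit Types (T : tree) (k a : nat) (X : seq nat).

Definition same_side k a : bool := if (s < k)%N then (s < a)%N else (a < s)%N.

(* The part of [X] on the same side of [s] as [k], with half of [s]: the two
   sides then share the whole weight of [X]. *)
Definition side_weight k X : R :=
  w s / 2 + weight w [seq a <- X | same_side k a].

Definition path_gain T k : R :=
  ln (weight w (inorder T)) - ln (side_weight k (inorder T)).

Definition root_gain T : R :=
  if T is Node _ k _ then (if k == s then 0 else path_gain T k) else 0.

Lemma side_weight_gt0 k X : 0 < w s -> (forall a, a \in X -> 0 < w a) ->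
  0 < side_weight k X.
Proof.
move=> ws hw; have h : 0 <= weight w [seq a <- X | same_side k a].
  by apply: weight_ge0 => a; rewrite mem_filter => /andP[_ /hw].
by rewrite /side_weight; lra.
Qed.

Lemma side_weight_add k k' X : (s < k)%N -> (k' < s)%N -> uniq X -> s \in X ->
  side_weight k X + side_weight k' X = weight w X.
Proof.
move=> sk ks uX sX; rewrite (weight_split R w s X uX sX) /side_weight.
rewrite /same_side sk ltnNge (ltnW ks) /=; lra.
Qed.

Lemma side_weight_le k X : 0 < w s -> (forall a, a \in X -> 0 < w a) ->
  uniq X -> s \in X -> side_weight k X <= weight w X.
Proof.
move=> ws hw uX sX; rewrite (weight_split R w s X uX sX) /side_weight /same_side.
have h p : 0 <= weight w [seq a <- X | p a].
  by apply: weight_ge0 => a; rewrite mem_filter => /andP[_ /hw].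
have h1 := h (fun a => a < s)%N; have h2 := h (fun a => s < a)%N.
by case: (s < k)%N; rewrite /=; lra.
Qed.

Lemma side_weight_mono k X Y : uniq X -> uniq Y -> {subset X <= Y} ->
  (forall a, a \in Y -> 0 < w a) -> side_weight k X <= side_weight k Y.
Proof.
move=> uX uY XY hw; rewrite lerD2l; apply: weight_sub; rewrite ?filter_uniq //.
  by move=> a; rewrite !mem_filter => /andP[-> /XY].
by move=> a; rewrite mem_filter => /andP[_ /hw].
Qed.

Lemma path_gain_ge0 T k : 0 < w s -> (forall a, a \in inorder T -> 0 < w a) ->
  uniq (inorder T) -> s \in inorder T -> 0 <= path_gain T k.
Proof.
move=> ws hw uT sT; rewrite subr_ge0 ler_ln ?posrE.
- exact: side_weight_le.
- exact: side_weight_gt0.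
- exact: (lt_le_trans ws (weight_ge R w _ s hw sT)).
Qed.

(** AM-GM in the form [4 * (x * y) <= (x + y) * (x + y)]. *)
Lemma ln_amgm (x y a : R) : 0 < x -> 0 < y -> x + y <= a ->
  ln x + ln y + 2 * ln 2 <= 2 * ln a.
Proof.
move=> x0 y0 xya; have a0 : 0 < a by lra.
have -> : ln x + ln y + 2 * ln 2 = ln (4 * (x * y)).
  rewrite (_ : 4 = 2 * 2); first by rewrite !lnM ?posrE ?mulr_gt0 //; ring.
  by ring.
have -> : 2 * ln a = ln (a * a) by rewrite lnM ?posrE //; ring.
rewrite ler_ln ?posrE ?mulr_gt0 //.
have h1 : (x + y) * (x + y) <= a * a by rewrite ler_pM //; lra.
have h2 : 0 <= (x - y) * (x - y) by rewrite -expr2 sqr_ge0.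
nra.
Qed.

(** The side weights of [k] and [k'] in [T] add up to the whole weight of [T], and that of [k'] only
    shrinks in [T'], so AM-GM applies. The difference of logarithms on the left telescopes along the
    path. *)
Lemma alternation_pair_gain T T' k k' : 0 < w s ->
  (forall a, a \in inorder T -> 0 < w a) -> uniq (inorder T) ->
  uniq (inorder T') -> {subset inorder T' <= inorder T} ->
  s \in inorder T' -> (s < k)%N && (k' < s)%N || (k < s)%N && (s < k')%N ->
  2 * ln 2 + ln (weight w (inorder T')) - ln (weight w (inorder T))
  <= path_gain T k + path_gain T' k'.
Proof.
move=> ws hw uT uT' sub sT' alt.
have hw' a : a \in inorder T' -> 0 < w a by move=> /sub/hw.
have mono := side_weight_mono k' _ _ uT' uT sub hw.
have e : side_weight k (inorder T) + side_weight k' (inorder T)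
         = weight w (inorder T).
  case/orP: alt => /andP[h h'].
    by apply: side_weight_add => //; exact: sub.
  by rewrite addrC; apply: side_weight_add => //; exact: sub.
have := @ln_amgm (side_weight k (inorder T)) (side_weight k' (inorder T'))
  (weight w (inorder T)) (side_weight_gt0 k _ ws hw) (side_weight_gt0 k' _ ws hw').
rewrite /path_gain => /(_ ltac:(lra)); lra.
Qed.

Lemma path_gain_root_child T T' k k' : 0 < w s ->
  (forall a, a \in inorder T -> 0 < w a) -> uniq (inorder T) ->
  uniq (inorder T') -> {subset inorder T' <= inorder T} ->
  s \in inorder T' -> k != s -> k' != s ->
  2 * ln 2 * ((k < s < k')%N || (k' < s < k)%N)%:R
  + ln (weight w (inorder T')) - ln (weight w (inorder T))
  <= path_gain T k + path_gain T' k'.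
Proof.
move=> ws hw uT uT' sub sT' ks ks'.
have hw' a : a \in inorder T' -> 0 < w a by move=> /sub/hw.
have [alt|_] := boolP (_ || _).
  have := alternation_pair_gain _ _ k k' ws hw uT uT' sub sT'.
  by rewrite mulr1; apply; move: alt; lia.
have h1 := path_gain_ge0 T k ws hw uT (sub _ sT').
have h2 := path_gain_ge0 T' k' ws hw' uT' sT'.
have h3 : ln (weight w (inorder T')) <= ln (weight w (inorder T)).
  rewrite ler_ln ?posrE; first exact: weight_sub.
  - exact: (lt_le_trans ws (weight_ge R w _ s hw' sT')).
  - exact: (lt_le_trans ws (weight_ge R w _ s hw (sub _ sT'))).
rewrite mulr0; lra.
Qed.

(* Each alternation is paid by the two nodes it joins, half of the gain of a
   node going to each of its two path edges; the unused half of the root is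
   kept in the induction. *)
Lemma alternation_gain T : 0 < w s -> sorted ltn (inorder T) ->
  s \in inorder T -> (forall a, a \in inorder T -> 0 < w a) ->
  2 * ln 2 * (side_alternations (search_path T s) s)%:R
  + ln (w s) - ln (weight w (inorder T)) + root_gain T
  <= 2 * \sum_(t <- search_path T s | t != s) path_gain (subtree T t) t.
Proof.
move=> ws.
(* Both directions of descent are treated at once: [T'] is the child that contains [s]. *)
have step l k r T' : sorted ltn (inorder (Node l k r)) ->
    (forall a, a \in inorder (Node l k r) -> 0 < w a) -> k != s ->
    (T' = l \/ T' = r) -> s \in inorder T' ->
    search_path (Node l k r) s = k :: search_path T' s ->
    (2 * ln 2 * (side_alternations (search_path T' s) s)%:R
     + ln (w s) - ln (weight w (inorder T')) + root_gain T'
     <= 2 * \sum_(t <- search_path T' s | t != s) path_gain (subtree T' t) t) ->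
    2 * ln 2 * (side_alternations (search_path (Node l k r) s) s)%:R
    + ln (w s) - ln (weight w (inorder (Node l k r))) + root_gain (Node l k r)
    <= 2 * \sum_(t <- search_path (Node l k r) s | t != s)
             path_gain (subtree (Node l k r) t) t.
  set T0 := Node l k r => sT hw ks T'lr sT' eP IH.
  have uT : uniq (inorder T0) by exact: (sorted_uniq ltn_trans ltnn).
  have [sl sr _ _] := sorted_node sT.
  have uT' : uniq (inorder T').
    by apply: (sorted_uniq ltn_trans ltnn); case: T'lr => ->.
  have sub : {subset inorder T' <= inorder T0}.
    by move=> a; rewrite mem_cat inE; case: T'lr => -> ->; rewrite ?orbT.
  have hw' a : a \in inorder T' -> 0 < w a by move=> /sub/hw.
  rewrite eP big_cons ks subtree_root -/T0.
  have -> : \sum_(t <- search_path T' s | t != s) path_gain (subtree T0 t) t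
          = \sum_(t <- search_path T' s | t != s) path_gain (subtree T' t) t.
    rewrite [LHS]big_seq_cond [RHS]big_seq_cond; apply: eq_bigr => t.
    case/andP=> /search_path_sub tT' _; congr path_gain.
    case: T'lr tT' => -> tT'; first exact: (subtree_left l k r t sT tT').
    exact: (subtree_right l k r t sT tT').
  have -> : root_gain T0 = path_gain T0 k by rewrite /= (negbTE ks).
  have h1 := path_gain_ge0 T0 k ws hw uT (sub _ sT').
  case: T' sT' {eP T'lr uT'} sub hw' IH (uT') => [|l' k' r'] // sT' sub hw' IH uT'.
  (* If the child is [s] itself, the path ends there without an alternation, and the nonnegative
     gain of the root suffices. *)
  have [ek|ks'] := eqVneq k' s.
    have -> : search_path (Node l' k' r') s = [:: s] by rewrite /= ek eqxx.
    rewrite side_alternations_cons big_cons big_nil eqxx /= !ltnn andbF mulr0.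
    have : ln (w s) <= ln (weight w (inorder T0)).
      rewrite ler_ln ?posrE //; first by apply: (weight_ge R) => //; apply: sub.
      exact: (lt_le_trans ws (weight_ge R w _ s hw (sub _ sT'))).
    lra.
  have := path_gain_root_child T0 _ k k' ws hw uT uT' sub sT' ks ks'.
  have er : root_gain (Node l' k' r') = path_gain (Node l' k' r') k'.
    by rewrite /= (negbTE ks').
  rewrite er in IH; move: IH.
  have [p ->] : exists p, search_path (Node l' k' r') s = k' :: p.
    by eexists.
  rewrite side_alternations_cons natrD mulrDr; lra.
elim: T => // l IHl k r IHr sT hs hw.
have [sl sr _ _] := sorted_node sT.
case: (ltngtP s k) => hsk.
- have ml := mem_left l k r s sT hs hsk.
  apply: (step l k r l) => //; [by rewrite gtn_eqF|by left| |].
    by rewrite /= ltn_eqF // hsk.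
  by apply: IHl => // a al; apply: hw; rewrite /= mem_cat al.
- have mr := mem_right l k r s sT hs hsk.
  apply: (step l k r r) => //; [by rewrite ltn_eqF|by right| |].
    by rewrite /= gtn_eqF // ltnNge ltnW.
  by apply: IHr => // a ar; apply: hw; rewrite /= mem_cat inE ar !orbT.
- subst k; rewrite /= eqxx big_cons big_nil eqxx /= mulr0 /side_alternations /=.
  rewrite mulr0 add0r addr0 subr_le0 ler_ln ?posrE //; first exact: weight_ge.
  exact: (lt_le_trans ws (weight_ge R w _ s hw hs)).
Qed.

End PathWeights.

(** * Change of potential in one access, and the access lemma *)

Lemma interval_logs_le (R : realType) (pm pp rho : nat -> R) (K : R) B
    (a b W : R) (D : nat) :
  0 <= K -> 0 < a -> layout pm pp B a b ->
  (forall k, k \in inorder B -> pm k <= rho k) ->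
  (right_levels B <= D)%N -> b <= W ->
  interval_logs pm pp B a b + K * (num_leaves B)%:R
  <= \sum_(k <- inorder B) ln (rho k) + (D%:R + expR K) * (ln W - ln a).
Proof.
move=> K0 a0 lay hrho hD bW; have ab := layout_le R pm pp B a b lay.
(* The scan starts with [D] entries equal to [W] and ends with [D] entries that are at least [a], so
   the levels lose at most [D%:R * (ln W - ln a)]. *)
have [||V [sV Va]] := interval_logs_scan R pm pp rho K B a b (nseq D W)
  K0 a0 lay hrho; first by rewrite size_nseq.
  by move=> u /nseqP[->].
rewrite size_nseq in sV.
have hV : D%:R * ln a <= \sum_(v <- V) ln v.
  have -> : D%:R * ln a = \sum_(v <- V) ln a.
    by rewrite big_const_seq count_predT sV iter_addr_0 mulr_natl.
  rewrite big_seq [leRHS]big_seq ler_sum // => v /Va av.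
  by rewrite ler_ln ?posrE //; lra.
have hU : \sum_(u <- nseq D W) ln u = D%:R * ln W.
  by rewrite big_nseq iter_addr_0 mulr_natl.
have hE : expR K * (ln b - ln a) <= expR K * (ln W - ln a).
  by rewrite ler_wpM2l ?expR_ge0 // lerD2r ler_ln ?posrE //; lra.
rewrite hU mulrDl mulrBr; lra.
Qed.

Lemma pos_gap (R : realType) (w : nat -> R) Z x y :
  uniq Z -> x \in Z -> (x < y)%N ->
  pos w Z y = pos w Z x + w x + weight w [seq a <- Z | (x < a < y)%N].
Proof.
move=> uZ xZ xy.
have xI : x \in [seq a <- Z | (a < y)%N] by rewrite mem_filter xy.
rewrite /pos (weight_split R w x _ (filter_uniq _ uZ) xI) -!filter_predI.
congr (weight w _ + _ + weight w _); apply: eq_filter => a //=.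
by case: ltnP => // ax; rewrite (ltn_trans ax xy).
Qed.

Lemma root_gain_ge0 (R : realType) (w : nat -> R) s T : 0 < w s ->
  sorted ltn (inorder T) -> s \in inorder T ->
  (forall a, a \in inorder T -> 0 < w a) -> 0 <= root_gain R w s T.
Proof.
case: T => // l k r ws sT hs hw; rewrite /root_gain; case: eqP => // _.
by apply: path_gain_ge0 => //; exact: (sorted_uniq ltn_trans ltnn).
Qed.

Lemma subtree_subseq T t : subseq (inorder (subtree T t)) (inorder T).
Proof.
elim: T => //= l IHl k r IHr; case: eqP => // _; case: ltnP => _.
  exact: subseq_trans IHl (prefix_subseq _ _).
apply: subseq_trans IHr _.
exact: subseq_trans (subseq_cons _ k) (suffix_subseq _ _).
Qed.

Section Access.
Variables (R : realType) (w : nat -> R) (T Al Ar : tree) (s D : nat) (K : R).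
Let A := Node Al s Ar.
Let log_weight (U : tree) : R := ln (weight w (inorder U)).

(** The root [s] splits the after-tree into two sides, the lower one being reflected. On each side
    [interval_logs_le] replaces the new logarithms by the [ln (rho t)], which are the old ones less
    the path gains; the two sides give the factor 2. *)
Lemma access_gain :
  sorted ltn (inorder T) -> s \in inorder T ->
  (forall a, a \in inorder T -> 0 < w a) ->
  bst_on (search_path T s) A ->
  (right_levels Ar <= D)%N -> (right_levels (mirror Al) <= D)%N -> 0 <= K ->
  tree_sum log_weight (tree_after T s A) + K * (num_leaves A)%:R
  + \sum_(t <- search_path T s | t != s) path_gain R w s (subtree T t) t
  <= tree_sum log_weight T + K
     + (2 * (D%:R + expR K) + 1) * (ln (weight w (inorder T)) - ln (w s / 2)).
Proof.
set Z := inorder T; set W := weight w Z => sT hs hw hA hDr hDl K0.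
have [eA eT'] := inorder_tree_after T s A sT hA.
have uT : uniq Z by exact: (sorted_uniq ltn_trans ltnn).
have ws : 0 < w s by exact: hw.
have a0 : 0 < w s / 2 by lra.
have sA : sorted ltn (inorder A) by case: hA.
have [sAl sAr ltAl gtAr] := sorted_node sA.
have pA : perm_eq (search_path T s) (inorder A).
  by rewrite eA perm_sym perm_path_inorder.
have wW : w s <= W by exact: weight_ge.
have szh : size (hanging T s) = (size (inorder A)).+1.
  by rewrite eA size_hanging.
have [lay sumT'] : 
    layout (pos w Z) (fun k => pos w Z k + w k) A 0 W /\
    tree_sum log_weight (tree_after T s A)
    = interval_logs (pos w Z) (fun k => pos w Z k + w k) A 0 W
      + \sum_(t <- hanging T s) tree_sum log_weight t.
  have := tree_sum_attach R w Z A (hanging T s) [::] [::] szh.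
  cbv zeta; rewrite cats0 !cat0s -/(tree_after T s A) eT' weight_nil.
  by move=> /(_ erefl sT hw).
have sumT := tree_sum_path R log_weight T s sT hs.
case: lay => layl _ layr.
set rho := fun t => side_weight R w s t (inorder (subtree T t)).
have sub_uniq t : uniq (inorder (subtree T t)).
  exact: subseq_uniq (subtree_subseq T t) uT.
have sub_mem t : {subset inorder (subtree T t) <= Z}.
  exact: mem_subseq (subtree_subseq T t).
(* Keys between [s] and [t] belong to the old subtree of [t], so [rho t] dominates any part of them
   on the side of [t]. *)
have rho_ge t (p : pred nat) : t \in search_path T s ->
    (forall a, a \in Z -> p a ->
       same_side s t a /\ ((s <= a <= t)%N || (t <= a <= s)%N)) ->
    w s / 2 + weight w [seq a <- Z | p a] <= rho t.
  move=> tP hp; rewrite lerD2l; apply: weight_sub; rewrite ?filter_uniq ?sub_uniq //.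
    move=> a; rewrite !mem_filter => /andP[pa aZ].
    have [-> /=] := hp a aZ pa.
    exact: subtree_path_convex.
  by move=> a; rewrite mem_filter => /andP[_ /sub_mem/hw].
have pos_s : 0 <= pos w Z s.
  by apply: weight_ge0 => a; rewrite mem_filter => /andP[_ /hw].
have memP t : t \in inorder A -> t \in search_path T s by rewrite (perm_mem pA).
have memZ t : t \in inorder A -> t \in Z by move=> /memP/search_path_sub.
(* Both sides are placed so that the end next to [s] becomes [w s / 2]. The near end of the interval
   of [k] is then [w s / 2] plus the weight strictly between [s] and [k], which is at most
   [rho k]. *)
have [layr' layl'] := (
  layout_shift R _ _ (w s / 2 - (pos w Z s + w s)) _ _ _ layr,
  layout_mirror R _ _ (w s / 2 + pos w Z s) _ _ _ layl).
have hr := interval_logs_le R _ _ rho K Ar _ _ W D K0 _ layr' _ hDr.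
have hl := interval_logs_le R _ _ rho K (mirror Al) _ _ W D K0 _ layl' _ hDl.
rewrite interval_logs_shift subrK in hr.
rewrite interval_logs_mirror addrK subr0 num_leaves_mirror in hl.
have {}hr : interval_logs (pos w Z) (fun k => pos w Z k + w k) Ar
      (pos w Z s + w s) W + K * (num_leaves Ar)%:R
    <= \sum_(k <- inorder Ar) ln (rho k)
       + (D%:R + expR K) * (ln W - ln (w s / 2)).
  apply: (hr a0) => [k kr|]; last lra.
  have kA : k \in inorder A by rewrite /= mem_cat inE kr !orbT.
  have sk := gtAr k kr.
  have gap := pos_gap R w Z s k uT hs sk.
  apply: le_trans (rho_ge k (fun a => s < a < k)%N (memP k kA) _).
    by rewrite gap; lra.
  move=> a _ /andP[sa ak]; rewrite /same_side sk sa.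
  by rewrite (ltnW sa) (ltnW ak).
have {}hl : interval_logs (pos w Z) (fun k => pos w Z k + w k) Al 0 (pos w Z s)
    + K * (num_leaves Al)%:R
    <= \sum_(k <- inorder Al) ln (rho k)
       + (D%:R + expR K) * (ln W - ln (w s / 2)).
  have -> : \sum_(k <- inorder Al) ln (rho k)
            = \sum_(k <- inorder (mirror Al)) ln (rho k).
    by rewrite inorder_mirror; apply: perm_big; rewrite perm_sym perm_rev.
  apply: (hl a0) => [k|].
    rewrite inorder_mirror mem_rev => kl.
    have kA : k \in inorder A by rewrite /= mem_cat kl.
    have ks := ltAl k kl.
    have gap := pos_gap R w Z k s uT (memZ k kA) ks.
    apply: le_trans (rho_ge k (fun a => k < a < s)%N (memP k kA) _).
      by rewrite gap; lra.
    move=> a _ /andP[ka as_]; rewrite /same_side ltnNge (ltnW ks) as_.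
    by rewrite (ltnW as_) (ltnW ka) orbT.
  rewrite /W (weight_split R w s Z uT hs) -/(pos w Z s).
  have : 0 <= weight w [seq a <- Z | (s < a)%N].
    by apply: weight_ge0 => a; rewrite mem_filter => /andP[_ /hw].
  lra.
(* The additional [K] covers the case in which [s] is the only node, and thus a leaf, of [A]. *)
have hleaves : K * (num_leaves A)%:R
               <= K * (num_leaves Al)%:R + K * (num_leaves Ar)%:R + K.
  rewrite -[X in _ <= _ + X]mulr1 -!mulrDr ler_wpM2l // -natrD natr1 ler_nat.
  rewrite num_leaves_node.
  by case: (Al) => [|? ? ?]; case: (Ar) => [|? ? ?] //; apply: leqnSn.
have sum_path (f : nat -> R) : \sum_(t <- search_path T s) f t
    = \sum_(t <- inorder Al) f t + f s + \sum_(t <- inorder Ar) f t.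
  by rewrite (perm_big _ pA) big_cat big_cons /= addrA.
have gains : \sum_(t <- search_path T s | t != s) path_gain R w s (subtree T t) t
    = \sum_(t <- search_path T s) log_weight (subtree T t)
      - log_weight (subtree T s)
      - \sum_(t <- inorder Al) ln (rho t) - \sum_(t <- inorder Ar) ln (rho t).
  rewrite big_mkcond !sum_path eqxx.
  have off X : (forall t, t \in X -> t != s) ->
      \sum_(t <- X) (if t != s then path_gain R w s (subtree T t) t else 0)
      = \sum_(t <- X) log_weight (subtree T t) - \sum_(t <- X) ln (rho t).
    move=> hX; rewrite -sumrB big_seq [RHS]big_seq.
    by apply: eq_bigr => t /hX ->.
  rewrite !off; last 2 first.
  - by move=> t /gtAr; case: ltngtP.
  - by move=> t /ltAl; case: ltngtP.
  by rewrite /=; ring.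
(* The node [s] has weight [W] in the new tree and at least [w s / 2] in the old one; this accounts
   for the [+ 1] in the constant. *)
have ln_s : ln (w s / 2) <= log_weight (subtree T s).
  have sP : s \in search_path T s by rewrite (perm_mem pA) mem_cat mem_head orbT.
  have ss : s \in inorder (subtree T s).
    by apply: (subtree_path_convex T s) => //; rewrite leqnn.
  have := @weight_ge R w _ s (fun a ha => hw a (sub_mem _ a ha)) ss.
  by move=> h; rewrite ler_ln ?posrE; lra.
rewrite sumT' sumT gains [interval_logs _ _ A _ _]/= subr0 -/W; lra.
Qed.

End Access.

Theorem theorem1 (R : realType) (alg : algorithm) (c C : R)
    (hmsa : minimally_self_adjusting alg)
    (hc : 0 < c) (hC : 0 <= C)
    (hleaves : forall (n : nat) (T : tree) (s : nat) (A : tree),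
       bst_on (keys n) T -> s \in keys n -> alg T s A ->
       c * ((size (search_path T s))%:R
            - (side_alternations (search_path T s) s)%:R)
         <= (num_leaves A)%:R)
    (hdepth : forall (n : nat) (T : tree) (s : nat) (A : tree),
       bst_on (keys n) T -> s \in keys n -> alg T s A ->
       forall t : nat, t \in inorder A ->
         ((s < t)%N -> (right_depth A t)%:R <= C) /\
         ((t < s)%N -> (left_depth A t)%:R <= C)) :
  access_lemma R alg.
Proof.
set l2 : R := ln 2.
have l2_gt0 : 0 < l2 by apply: ln_gt0; lra.
(* Since [K * c = l2], the leaves pay one binary unit for each of the [|P| - z] nodes. [D] is a
   natural number above [C], and [M] is the constant of [access_gain]. *)
pose K := l2 / c; pose D := Num.bound C; pose M := 2 * (D%:R + expR K) + 1.
have K0 : 0 <= K by rewrite divr_ge0 // ltW.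
have CD : C < D%:R by exact: archi_boundP.
(* [K / l2] absorbs the additive [K] of [access_gain], [M] its logarithmic error, and 1 the
   logarithmic loss of [alternation_gain]. *)
exists (K / l2 + M + 1) => n T w s A hT hw hs hA.
have [sT eT] := hT.
have inT : inorder T = keys n.
  exact: irr_sorted_eq ltn_trans ltnn _ _ sT (iota_ltn_sorted _ _) eT.
have [_ /(_ A hA)[hPA]] := hmsa _ _ _ hT hs.
case: A hA hPA => // Al s' Ar hA hPA; rewrite /root_is => es; subst s'.
set A := Node Al s Ar in hA hPA *.
have sA : sorted ltn (inorder A) by case: hPA.
have [sAl sAr ltAl gtAr] := sorted_node sA.
have hwT a : a \in inorder T -> 0 < w a by rewrite inT; apply: hw.
have hsT : s \in inorder T by rewrite inT.
have [_ eT'] := inorder_tree_after T s A sT hPA.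
have hDr : (right_levels Ar <= D)%N.
  (* The right edge from [s] makes depths in [Ar] one smaller than in [A], which supplies the strict
     bound by [D]. *)
  apply: right_levels_le => // t tr; have st := gtAr t tr.
  have tA : t \in inorder A by rewrite mem_cat inE tr !orbT.
  have [/(_ st) h _] := hdepth _ _ _ _ hT hs hA t tA.
  rewrite -(ler_nat R); move: h.
  by rewrite /= gtn_eqF // ltnNge ltnW //= => /le_trans/(_ (ltW CD)).
have hDl : (right_levels (mirror Al) <= D)%N.
  apply: right_levels_mirror_le => // t tl; have ts := ltAl t tl.
  have tA : t \in inorder A by rewrite mem_cat tl.
  have [_ /(_ ts) h] := hdepth _ _ _ _ hT hs hA t tA.
  rewrite -(ler_nat R); move: h.
  by rewrite /= ltn_eqF // ts => /le_trans/(_ (ltW CD)).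
have gain := access_gain R w T Al Ar s D K sT hsT hwT hPA hDr hDl K0.
have ws : 0 < w s by exact: hw.
have alt := alternation_gain R w s T ws sT hsT hwT.
have rg := root_gain_ge0 R w s T ws sT hsT hwT.
have leaves := hleaves _ _ _ _ hT hs hA.
have {}leaves : l2 * ((size (search_path T s))%:R
    - (side_alternations (search_path T s) s)%:R) <= K * (num_leaves A)%:R.
  have -> : l2 = K * c by rewrite /K divfK // gt_eqF.
  by rewrite -mulrA ler_wpM2l.
have pot U : inorder U = keys n ->
    potential w U (keys n)
    = tree_sum (fun V => ln (weight w (inorder V))) U / l2.
  move=> eU; rewrite -tree_sum_inorder ?eU ?iota_ltn_sorted //.
  by rewrite mulr_suml.
rewrite !pot ?eT' //.
have wW : w s <= weight w (keys n) by exact: weight_ge.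
rewrite /log2 ln_div ?posrE //; last by lra.
have lws : ln (w s / 2) = ln (w s) - l2 by rewrite ln_div ?posrE.
have delta_ge0 : 0 <= ln (weight w (keys n)) - ln (w s).
  by rewrite subr_ge0 ler_ln ?posrE //; lra.
rewrite -/A inT -/M lws in gain; rewrite inT -/l2 in alt.
move: gain alt delta_ge0; rewrite -/l2.
set S := tree_sum _ T; set S' := tree_sum _ (tree_after T s A).
set lW := ln (weight w (keys n)); set lw := ln (w s).
set G := \sum_(_ <- _ | _) _; set m := (size _)%:R; set z := (side_alternations _ _)%:R.
move=> gain alt delta_ge0.
have KM : 0 <= K / l2 by rewrite divr_ge0 // ltW.
have -> : S / l2 - S' / l2 + (K / l2 + M + 1) * (1 + (lW - lw) / l2)
   = (S - S' + K + M * (l2 + (lW - lw)) + l2 + (lW - lw)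
      + K / l2 * (lW - lw)) / l2.
  by field; rewrite gt_eqF.
rewrite ler_pdivlMr // mulrC.
have h : 0 <= K / l2 * (lW - lw) by rewrite mulr_ge0.
have e1 : M * (lW - (lw - l2)) = M * (l2 + (lW - lw)) by ring.
(* Half of [alt] bounds [G] below by [l2 * z - (lW - lw) / 2], and [leaves] contributes
   [l2 * (m - z)]; together they yield [l2 * m]. *)
rewrite e1 in gain; lra.
Qed.
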